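(* Let $(E,S,P)$ be a pmf-structure (as defined in the context). Then for all $x,y\in E$: (1) (probability upper bound) $P(x)\le 1$, i.e. $\mathbf{s}(\mathbf{s}(1-P(x))+1)=1$; (2) (joint probability factorization) $P(x,y)=P(x\mid y)\cdot P(y)$; (3) (Bayes' rule) $P(x\mid y)=\dfrac{P(y\mid x)\cdot P(x)}{P(y)}$.
   Context: Two-sorted signature: an event sort $E$ with binary operations $\vee,\wedge$, unary $\neg$, constants $\top,\bot$; a stalk sort $S$ with binary $+,\cdot$, unary $-$ (additive inverse), unary ${}^{-1}$ (inverse), unary $\mathbf{s}$ (sign), constants $0,1$; and a function $P:E\to S$. Abbreviations: $p-q=p+(-q)$, $1_p=p\cdot p^{-1}$, $0_p=1-1_p$, $\frac{p}{q}=p/q=p\cdot q^{-1}$, $P(x,y)=P(x\wedge y)$, $P(x\mid y)=\frac{P(x,y)}{P(y)}$, and $p\le q$ means $\mathbf{s}(\mathbf{s}(q-p)+1)=1$. A pmf-structure is a structure for this signature satisfying, for all values of the variables, the following equations (APMF). Boolean algebra: $(x\vee y)\wedge y=y$; $(x\wedge y)\vee y=y$; $x\wedge(y\vee z)=(y\wedge x)\vee(z\wedge x)$; $x\vee(y\wedge z)=(y\vee x)\wedge(z\vee x)$; $x\wedge\neg x=\bot$; $x\vee\neg x=\top$. Meadow: $(x+y)+z=x+(y+z)$; $x+y=y+x$; $x+0=x$; $x+(-x)=0$; $(x\cdot y)\cdot z=x\cdot(y\cdot z)$; $x\cdot y=y\cdot x$; $1\cdot x=x$; $x\cdot(y+z)=x\cdot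 y+x\cdot z$; $(x^{-1})^{-1}=x$; $x\cdot(x\cdot x^{-1})=x$. Sign: $\mathbf{s}(1_x)=1_x$; $\mathbf{s}(0_x)=0_x$; $\mathbf{s}(-1)=-1$; $\mathbf{s}(x^{-1})=\mathbf{s}(x)$; $\mathbf{s}(x\cdot y)=\mathbf{s}(x)\cdot\mathbf{s}(y)$; $0_{\mathbf{s}(x)-\mathbf{s}(y)}\cdot(\mathbf{s}(x+y)-\mathbf{s}(x))=0$. Pmf (with $x,y$ events): $P(\top)=1$; $P(\bot)=0$; $\mathbf{s}(\mathbf{s}(P(x))+1)=1$; $P(x\vee y)=P(x)+P(y)-P(x\wedge y)$; $P(x\wedge y)\cdot P(y)\cdot P(y)^{-1}=P(x\wedge y)$. *)

(* Defs.v *)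
Record pmf_signature : Type := PmfSignature {
  event : Type;
  stalk : Type;
  ejoin : event -> event -> event;
  emeet : event -> event -> event;
  ecompl : event -> event;
  etop : event;
  ebot : event;
  sadd : stalk -> stalk -> stalk;
  smul : stalk -> stalk -> stalk;
  sopp : stalk -> stalk;
  sinv : stalk -> stalk;
  sgn : stalk -> stalk;
  szero : stalk;
  sone : stalk;
  prob : event -> stalk
}.

Arguments ejoin {p} _ _.
Arguments emeet {p} _ _.
Arguments ecompl {p} _.
Arguments etop {p}.
Arguments ebot {p}.
Arguments sadd {p} _ _.
Arguments smul {p} _ _.
Arguments sopp {p} _.
Arguments sinv {p} _.
Arguments sgn {p} _.
Arguments szero {p}.
Arguments sone {p}.
Arguments prob {p} _.

Declare Scope event_scope.
Delimit Scope event_scope with event.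
Bind Scope event_scope with event.
Declare Scope stalk_scope.
Delimit Scope stalk_scope with stalk.
Bind Scope stalk_scope with stalk.

Notation "x \/ y" := (ejoin x y) : event_scope.
Notation "x /\ y" := (emeet x y) : event_scope.
Notation "~ x" := (ecompl x) : event_scope.

Notation "p + q" := (sadd p q) : stalk_scope.
Notation "p * q" := (smul p q) : stalk_scope.
Notation "- p" := (sopp p) : stalk_scope.
Notation "/ p" := (sinv p) : stalk_scope.
Notation "0" := szero : stalk_scope.
Notation "1" := sone : stalk_scope.

Definition ssub {M : pmf_signature} (p q : stalk M) : stalk M :=
  (p + (- q))%stalk.
Notation "p - q" := (ssub p q) : stalk_scope.

Definition sdiv {M : pmf_signature} (p q : stalk M) : stalk M :=
  (p * / q)%stalk.
Notation "p / q" := (sdiv p q) : stalk_scope.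

(* [one_at p] is 1_p and [zero_at p] is 0_p. *)
Definition one_at {M : pmf_signature} (p : stalk M) : stalk M :=
  (p * / p)%stalk.
Definition zero_at {M : pmf_signature} (p : stalk M) : stalk M :=
  (1 - one_at p)%stalk.

Definition sle {M : pmf_signature} (p q : stalk M) : Prop :=
  sgn (sgn (q - p) + 1)%stalk = 1%stalk.
Notation "p <= q" := (sle p q) : stalk_scope.

Definition joint_prob {M : pmf_signature} (x y : event M) : stalk M :=
  prob (x /\ y)%event.

Definition cond_prob {M : pmf_signature} (x y : event M) : stalk M :=
  (joint_prob x y / prob y)%stalk.

Record boolean_axioms (M : pmf_signature) : Prop := BooleanAxioms {
  emeet_absorb : forall x y : event M, ((x \/ y) /\ y)%event = y;
  ejoin_absorb : forall x y : event M, ((x /\ y) \/ y)%event = y;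
  emeet_join_distr : forall x y z : event M,
    (x /\ (y \/ z))%event = ((y /\ x) \/ (z /\ x))%event;
  ejoin_meet_distr : forall x y z : event M,
    (x \/ (y /\ z))%event = ((y \/ x) /\ (z \/ x))%event;
  emeet_compl : forall x : event M, (x /\ ~ x)%event = ebot;
  ejoin_compl : forall x : event M, (x \/ ~ x)%event = etop
}.

Record meadow_axioms (M : pmf_signature) : Prop := MeadowAxioms {
  sadd_assoc : forall x y z : stalk M,
    ((x + y) + z)%stalk = (x + (y + z))%stalk;
  sadd_comm : forall x y : stalk M, (x + y)%stalk = (y + x)%stalk;
  sadd_0_r : forall x : stalk M, (x + 0)%stalk = x;
  sadd_opp_r : forall x : stalk M, (x + (- x))%stalk = 0%stalk;
  smul_assoc : forall x y z : stalk M,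
    ((x * y) * z)%stalk = (x * (y * z))%stalk;
  smul_comm : forall x y : stalk M, (x * y)%stalk = (y * x)%stalk;
  smul_1_l : forall x : stalk M, (1 * x)%stalk = x;
  smul_add_distr : forall x y z : stalk M,
    (x * (y + z))%stalk = (x * y + x * z)%stalk;
  sinv_involutive : forall x : stalk M, (/ (/ x))%stalk = x;
  smul_restricted_inv : forall x : stalk M, (x * (x * / x))%stalk = x
}.

Record sign_axioms (M : pmf_signature) : Prop := SignAxioms {
  sgn_one_at : forall x : stalk M, sgn (one_at x) = one_at x;
  sgn_zero_at : forall x : stalk M, sgn (zero_at x) = zero_at x;
  sgn_opp_1 : sgn (- @sone M)%stalk = (- @sone M)%stalk;
  sgn_inv : forall x : stalk M, sgn (/ x)%stalk = sgn x;
  sgn_mul : forall x y : stalk M, sgn (x * y)%stalk = (sgn x * sgn y)%stalk;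
  sgn_add : forall x y : stalk M,
    (zero_at (sgn x - sgn y) * (sgn (x + y) - sgn x))%stalk = 0%stalk
}.

Record prob_axioms (M : pmf_signature) : Prop := ProbAxioms {
  prob_top : prob (@etop M) = 1%stalk;
  prob_bot : prob (@ebot M) = 0%stalk;
  prob_nonneg : forall x : event M, sgn (sgn (prob x) + 1)%stalk = 1%stalk;
  prob_join : forall x y : event M,
    prob (x \/ y)%event = (prob x + prob y - prob (x /\ y)%event)%stalk;
  prob_meet_support : forall x y : event M,
    (prob (x /\ y)%event * prob y * / prob y)%stalk = prob (x /\ y)%event
}.

Record pmf_structure : Type := PmfStructure {
  pmf_sig :> pmf_signature;
  pmf_boolean : boolean_axioms pmf_sig;
  pmf_meadow : meadow_axioms pmf_sig;
  pmf_sign : sign_axioms pmf_sig;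
  pmf_prob : prob_axioms pmf_sig
}.

(* Main.v *)
From Stdlib Require Import Setoid.
Require Import Defs.

(* Complementation gives 1 - P(x) = P(~ x), so nonnegativity of P(~ x) is the
   upper bound on P(x).  The factorization is the support axiom rearranged, and
   Bayes' rule follows from it and the commutativity of meet. *)

(** One absorption law expands the first [x] to [(x /\ x) \/ x]; the other then collapses the meet
    with [x]. *)
Lemma emeet_idem (M : pmf_signature) (HB : boolean_axioms M) (x : event M) :
  (x /\ x)%event = x.
Proof.
  rewrite <- (ejoin_absorb M HB x x) at 1.
  apply (emeet_absorb M HB).
Qed.

Lemma ejoin_idem (M : pmf_signature) (HB : boolean_axioms M) (x : event M) :
  (x \/ x)%event = x.
Proof.
  rewrite <- (emeet_absorb M HB x x) at 1.
  apply (ejoin_absorb M HB).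
Qed.

(* The distributivity axiom swaps the arguments of meet; idempotence of join
   isolates that swap. *)
Lemma emeet_comm (M : pmf_signature) (HB : boolean_axioms M) (x y : event M) :
  (x /\ y)%event = (y /\ x)%event.
Proof.
  rewrite <- (ejoin_idem M HB y) at 1.
  rewrite (emeet_join_distr M HB).
  apply (ejoin_idem M HB).
Qed.

Lemma sadd_subK (M : pmf_signature) (HM : meadow_axioms M) (p q : stalk M) :
  (p + q - p)%stalk = q.
Proof.
  unfold ssub.
  rewrite (sadd_comm M HM p q), (sadd_assoc M HM), (sadd_opp_r M HM).
  apply (sadd_0_r M HM).
Qed.

Lemma ssub_0_r (M : pmf_signature) (HM : meadow_axioms M) (p : stalk M) :
  (p - 0)%stalk = p.
Proof.
  (* With [p] written as [0 + p], subtracting [0] is a cancellation. *)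
  rewrite <- (sadd_0_r M HM p) at 1.
  rewrite (sadd_comm M HM p).
  apply (sadd_subK M HM).
Qed.

Lemma prob_compl (M : pmf_structure) (x : event M) :
  prob (~ x)%event = (1 - prob x)%stalk.
Proof.
  destruct M as [M HB HM HS HP]; simpl in *.
  (* Read [1] as the probability of [x \/ ~ x] and expand; the overlap is [ebot], of probability
     [0]. *)
  rewrite <- (prob_top M HP), <- (ejoin_compl M HB x), (prob_join M HP).
  rewrite (emeet_compl M HB), (prob_bot M HP), (ssub_0_r M HM).
  symmetry; apply (sadd_subK M HM).
Qed.

Lemma prob_le_1 (M : pmf_structure) (x : event M) : (prob x <= 1)%stalk.
Proof.
  unfold sle.
  rewrite <- prob_compl.
  apply (prob_nonneg M (pmf_prob M)).
Qed.

Lemma joint_prob_factor (M : pmf_structure) (x y : event M) :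
  joint_prob x y = (cond_prob x y * prob y)%stalk.
Proof.
  destruct M as [M HB HM HS HP]; simpl in *.
  unfold cond_prob, sdiv, joint_prob.
  (* Put [prob y] before its inverse, as in the support axiom. *)
  rewrite (smul_assoc M HM), (smul_comm M HM (/ prob y)%stalk).
  rewrite <- (smul_assoc M HM).
  symmetry; apply (prob_meet_support M HP).
Qed.

Theorem theorem1 (M : pmf_structure) (x y : event M) :
  (prob x <= 1)%stalk
  /\ joint_prob x y = (cond_prob x y * prob y)%stalk
  /\ cond_prob x y = ((cond_prob y x * prob x) / prob y)%stalk.
Proof.
  split; [apply prob_le_1 | split; [apply joint_prob_factor |]].
  (* The numerator on the right is [joint_prob y x], so only the order of the meet differs. *)
  rewrite <- joint_prob_factor.
  unfold cond_prob, joint_prob.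
  now rewrite (emeet_comm M (pmf_boolean M) x y).
Qed.
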